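(* Let $F\subset\mathbb{R}^2$ be compact, convex, and have nonempty interior. Then: (a) the infimum defining the critical escape diameter $D(F)$ is attained by a rectifiable closed path (that is, there is a rectifiable closed diameter-escape path $\gamma$ for $F$ with $\operatorname{diam}\gamma=D(F)$); (b) $D(F)=\rho_{\mathrm{diam}}(F)$; (c) the scaled body $F^{\sharp}:=D(F)^{-1}F$ is a Lebesgue universal cover and $$\operatorname{Area}(F^{\sharp})=\frac{\operatorname{Area}(F)}{D(F)^2};$$ (d) the Lebesgue universal covering constant admits the exact dual representation $$\mathcal{L}=\inf_{F}\frac{\operatorname{Area}(F)}{D(F)^2},$$ where the infimum is over all compact convex sets $F\subset\mathbb{R}^2$ with nonempty interior.
   Context: $O(2)$ is the full orthogonal group; a planar rigid motion is a map $x\mapsto a+Qx$ with $a\in\mathbb{R}^2$, $Q\in O(2)$, and a rigid copy of $S$ is a set $a+QS$. A set $F$ covers a compact set $S$ if $a+QS\subset F$ for some such $a,Q$. A Lebesgue universal cover is a compact convex set $F\subset\mathbb{R}^2$ with nonempty interior that covers every compact $S\subset\mathbb{R}^2$ with $\operatorname{diam}S\le 1$. The Lebesgue universal covering constant is $\mathcal{L}:=\inf\{\operatorname{Area}(F): F\subset\mathbb{R}^2\text{ is a Lebesgue universal cover}\}$. A closed path is a continuous map $\gamma:[0,1]\to\mathbb{R}^2$ with $\gamma(0)=\gamma(1)$; its trace is $\Gamma=\gamma([0,1])$ and $\operatorname{diam}\gamma:=\operatorname{diam}\Gamma$. For $F$ compact convex with nonempty interior, $\gamma$ is a (closed) diameter-escape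 path for $F$ if $a+Q\Gamma\not\subset\operatorname{int}F$ for every $a\in\mathbb{R}^2$, $Q\in O(2)$. The critical escape diameter is $D(F):=\inf\{\operatorname{diam}\gamma:\gamma\text{ is a closed diameter-escape path for }F\}$. The interior diameter-covering radius is $\rho_{\mathrm{diam}}(F):=\sup\{d\ge 0:\text{ every compact }S\subset\mathbb{R}^2\text{ with }\operatorname{diam}S<d\text{ has a rigid copy contained in }\operatorname{int}F\}$. *)

(* Defs.v *)
From HB Require Import structures.
From mathcomp Require Import all_boot all_order all_algebra.
From mathcomp Require Import all_classical all_reals all_analysis.

Set Implicit Arguments.
Unset Strict Implicit.
Unset Printing Implicit Defensive.

Import Order.TTheory GRing.Theory Num.Theory.
Import numFieldNormedType.Exports.

Local Open Scope classical_set_scope.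
Local Open Scope ring_scope.

Section Plane.
Context {R : realType}.
Implicit Types (S F : set 'cV[R]_2) (gamma : R -> 'cV[R]_2).

(* The library norm on matrices is the max norm: it induces the usual topology
   of the plane, but distances must be measured with the Euclidean norm. *)
Definition enorm (x : 'cV[R]_2) : R := Num.sqrt (\sum_(i < 2) x i ord0 ^+ 2).

Definition diam S : R := sup [set enorm (x - y) | x in S & y in S].

(* The matrix space carries no measure in the library, so the area is the
   product Lebesgue measure of the set of coordinate pairs. *)
Definition area S : \bar R :=
  ((@lebesgue_measure R) \x (@lebesgue_measure R))%E
    [set (x ord0 ord0, x ord_max ord0) | x in S].

Definition orthogonal_mx (Q : 'M[R]_2) : Prop := Q *m Q^T = 1%:M.

Definition rigid_copy (a : 'cV[R]_2) (Q : 'M[R]_2) S : set 'cV[R]_2 :=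
  [set a + Q *m x | x in S].

Definition scale_set (c : R) S : set 'cV[R]_2 := [set c *: x | x in S].

Definition covers F S : Prop :=
  exists a Q, orthogonal_mx Q /\ rigid_copy a Q S `<=` F.

Definition convex_body F : Prop :=
  [/\ compact F, convex_set (F : set (convex_lmodType 'cV[R]_2))
    & F° !=set0].

Definition lebesgue_universal_cover F : Prop :=
  convex_body F /\ forall S, compact S -> diam S <= 1 -> covers F S.

Definition universal_covering_constant : \bar R :=
  ereal_inf [set area F | F in lebesgue_universal_cover].

(* A path is a function on R of which only the restriction to [0, 1] matters. *)
Definition closed_path gamma : Prop :=
  {within `[0, 1], continuous gamma} /\ gamma 0 = gamma 1.

Definition trace gamma : set 'cV[R]_2 := gamma @` `[0, 1].

Definition path_diam gamma : R := diam (trace gamma).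

Definition polygonal_length gamma (s : seq R) : R :=
  let t := nth 1 (0 :: s) in
  \sum_(0 <= i < size s) enorm (gamma (t i.+1) - gamma (t i)).

Definition rectifiable gamma : Prop :=
  has_ubound [set polygonal_length gamma s | s in itv_partition 0 1].

Definition escape_path F gamma : Prop :=
  closed_path gamma /\
  forall a Q, orthogonal_mx Q -> ~ (rigid_copy a Q (trace gamma) `<=` F°).

(* [inf] and [sup] are 0 for sets without a real infimum or supremum; for a
   convex body F neither case occurs in the next two definitions. *)
Definition escape_diameter F : R :=
  inf [set path_diam gamma | gamma in escape_path F].

Definition diam_covering_radius F : R :=
  sup [set d : R | 0 <= d /\
         forall S, compact S -> diam S < d -> covers F° S].

End Plane.

(* Main.v *)
Require Import Defs.
From HB Require Import structures.
From mathcomp Require Import all_boot all_order all_algebra.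
From mathcomp Require Import all_classical all_reals all_analysis.
From mathcomp Require Import measurable_realfun ring lra.

Set Implicit Arguments.
Unset Strict Implicit.
Unset Printing Implicit Defensive.

Import Order.TTheory GRing.Theory Num.Theory.
Import numFieldNormedType.Exports.

Local Open Scope classical_set_scope.
Local Open Scope ring_scope.

(** Everything is compared with the covering radius [rho] of [F].

    Every escape path has diameter at least [rho], since a path of smaller
    diameter has a compact trace, which therefore fits in the interior
    ([escape_diam_ge]). What has to be found is a rectifiable closed escape path
    of diameter at most [rho]. For every [d > rho] some compact set [S] of
    diameter less than [d] does not fit. It is turned into a path as follows
    ([escape_loop_of_compact]). The intersection [K] of all discs of radius [d]
    centred at the points that are within [d] of all of [S] is a compact convex
    set containing [S], again of diameter at most [d]. Let a point run along a
    circle surrounding [K] and project it to [K]. Since the projection is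
    1-Lipschitz, this is a closed path whose Lipschitz constant is that of the
    circle, whatever [S] is; and it lies in [K]. Every linear form attains its
    maximum on [K] at a point of the path, so a convex set containing the path,
    with some room to spare, contains [K] ([circle_projections_hull]): if the path
    fitted in the open convex set [F°], then so would [S].

    The loops obtained for [d] decreasing to [rho] are uniformly bounded and
    equi-Lipschitz. A pointwise cluster point of them, given by Tychonoff's
    theorem, is a Lipschitz loop of diameter at most [rho]; and it escapes,
    because fitting in an open set is stable under small uniform perturbations
    ([escape_loop_limit]). Lipschitz paths are rectifiable, so the infimum is
    attained and equals [rho] ([critical_escape_loop], [escape_diameter_radius]).

    A compact set of diameter exactly [rho] need not fit in the interior of [F],
    but it fits in [F]: shrink it slightly, and take a limit of the resulting
    rigid motions ([covers_le_radius]). After scaling by [1 / rho] this says that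
    [F / rho] is a universal cover. Areas scale quadratically because Lebesgue
    measure on the line scales linearly and a product measure is determined by
    its values on rectangles ([area_scale]).

    Finally, each ratio [area F / rho ^ 2] is the area of the universal cover
    [F / rho]. Conversely a universal cover has [rho >= 1]
    ([universal_cover_radius_ge1]), so its ratio is at most its area; the two
    infima agree. *)

(** * Euclidean geometry of the plane *)

Section Euclid.
Context {R : realType}.
Implicit Types (x y z p u v w a : 'cV[R]_2) (Q : 'M[R]_2) (S F K : set 'cV[R]_2).

Lemma sum_ord2 (f : 'I_2 -> R) : \sum_(i < 2) f i = f ord0 + f ord_max.
Proof.
by rewrite !big_ord_recl big_ord0 addr0; congr (_ + f _); apply/val_inj.
Qed.

Lemma ord2_ind (P : 'I_2 -> Prop) : P ord0 -> P ord_max -> forall i, P i.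
Proof.
move=> P0 P1 [[|[|//]] i2].
- by rewrite (_ : Ordinal _ = ord0)//; apply/val_inj.
- by rewrite (_ : Ordinal _ = ord_max)//; apply/val_inj.
Qed.

Definition dot x y : R := \sum_(i < 2) x i ord0 * y i ord0.

Lemma dotE x y : dot x y =
  x ord0 ord0 * y ord0 ord0 + x ord_max ord0 * y ord_max ord0.
Proof. exact: sum_ord2. Qed.

Lemma dotC x y : dot x y = dot y x.
Proof. by rewrite !dotE; ring. Qed.

Lemma dotDl x y z : dot (x + y) z = dot x z + dot y z.
Proof. by rewrite !dotE !mxE; ring. Qed.

Lemma dotNl x z : dot (- x) z = - dot x z.
Proof. by rewrite !dotE !mxE; ring. Qed.

Lemma dotZl c x z : dot (c *: x) z = c * dot x z.
Proof. by rewrite !dotE !mxE; ring. Qed.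

Lemma dotDr x y z : dot z (x + y) = dot z x + dot z y.
Proof. by rewrite !dotE !mxE; ring. Qed.

Lemma dotNr x z : dot z (- x) = - dot z x.
Proof. by rewrite !dotE !mxE; ring. Qed.

Lemma dotZr c x z : dot z (c *: x) = c * dot z x.
Proof. by rewrite !dotE !mxE; ring. Qed.

Definition dot_lin := (dotDl, dotDr, dotNl, dotNr, dotZl, dotZr).

Lemma dot_ge0 x : 0 <= dot x x.
Proof. by rewrite dotE addr_ge0// -expr2 sqr_ge0. Qed.

Lemma enorm_ge0 x : 0 <= enorm x.
Proof. exact: sqrtr_ge0. Qed.

Lemma enorm_sqr x : enorm x ^+ 2 = dot x x.
Proof.
rewrite sqr_sqrtr; last by rewrite sumr_ge0// => i _; rewrite sqr_ge0.
by apply: eq_bigr => i _; rewrite expr2.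
Qed.

Lemma enorm_leP x c : 0 <= c -> (enorm x <= c) = (dot x x <= c ^+ 2).
Proof. by move=> c0; rewrite -enorm_sqr ler_pXn2r// nnegrE// enorm_ge0. Qed.

Lemma enorm0 : enorm (0 : 'cV[R]_2) = 0.
Proof.
by apply/eqP; rewrite -sqrf_eq0 enorm_sqr dotE !mxE !mulr0 addr0.
Qed.

Lemma enorm0_eq0 x : enorm x = 0 -> x = 0.
Proof.
move/eqP; rewrite -sqrf_eq0 enorm_sqr dotE -!expr2 paddr_eq0 ?sqr_ge0//.
rewrite !sqrf_eq0 => /andP[/eqP x0 /eqP x1].
apply/colP; apply: ord2_ind; by rewrite !mxE.
Qed.

Lemma dot_gt0 x : x != 0 -> 0 < dot x x.
Proof.
move=> x0; rewrite lt_neqAle dot_ge0 andbT eq_sym -enorm_sqr sqrf_eq0.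
by apply: contraNneq x0 => /enorm0_eq0 ->.
Qed.

Lemma enormZ c x : enorm (c *: x) = `|c| * enorm x.
Proof.
apply/eqP; rewrite -(@eqrXn2 _ 2)// ?enorm_ge0// ?mulr_ge0// ?enorm_ge0//.
by rewrite exprMn !enorm_sqr dotZl dotZr mulrA -expr2 real_normK// num_real.
Qed.

Lemma enormN x : enorm (- x) = enorm x.
Proof. by rewrite -scaleN1r enormZ normrN1 mul1r. Qed.

Lemma enormBC x y : enorm (x - y) = enorm (y - x).
Proof. by rewrite -enormN opprB. Qed.

Lemma dot_le_enorm x y : dot x y <= enorm x * enorm y.
Proof.
apply: le_trans (ler_norm _) _.
rewrite -(@ler_pXn2r _ 2)// ?nnegrE// ?mulr_ge0// ?enorm_ge0//.
rewrite real_normK ?num_real// exprMn !enorm_sqr !dotE -subr_ge0.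
set a := x _ _; set b := y _ _; set c := x _ _; set d := y _ _.
by rewrite (_ : _ - _ = (a * d - c * b) ^+ 2) ?sqr_ge0//; ring.
Qed.

Lemma enormD x y : enorm (x + y) <= enorm x + enorm y.
Proof.
rewrite enorm_leP ?addr_ge0 ?enorm_ge0// !dot_lin (dotC y x) sqrrD !enorm_sqr.
by have := dot_le_enorm x y; lra.
Qed.

Lemma enorm_triangle y x z : enorm (x - z) <= enorm (x - y) + enorm (y - z).
Proof. by rewrite (le_trans _ (enormD _ _))// addrA subrK. Qed.

Lemma coord_le_enorm x i : `|x i ord0| <= enorm x.
Proof.
rewrite -(@ler_pXn2r _ 2)// ?nnegrE ?enorm_ge0// real_normK ?num_real//.
rewrite enorm_sqr dotE -!expr2.
by move: i; apply: ord2_ind; rewrite ?lerDl ?lerDr sqr_ge0.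
Qed.

Lemma enorm_le_coord x : enorm x <= `|x ord0 ord0| + `|x ord_max ord0|.
Proof.
rewrite enorm_leP ?addr_ge0// dotE -!expr2 sqrrD !real_normK ?num_real//.
have : 0 <= `|x ord0 ord0| * `|x ord_max ord0| by rewrite mulr_ge0.
by rewrite mulr2n; lra.
Qed.

Lemma dot_orthogonal Q x y : orthogonal_mx Q ->
  dot (Q *m x) (Q *m y) = dot x y.
Proof.
have dot_mx u v : dot u v = (u^T *m v) ord0 ord0.
  by rewrite mxE; apply: eq_bigr => i _; rewrite mxE.
move=> /mulmx1C QQ.
by rewrite !dot_mx trmx_mul mulmxA -(mulmxA _ Q^T) QQ mulmx1.
Qed.

Lemma enorm_orthogonal Q x : orthogonal_mx Q -> enorm (Q *m x) = enorm x.
Proof.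
move=> oQ; apply/eqP; rewrite -(@eqrXn2 _ 2)// ?enorm_ge0//.
by rewrite !enorm_sqr dot_orthogonal.
Qed.

Lemma orthogonal_mx1 : orthogonal_mx (1%:M : 'M[R]_2).
Proof. by rewrite /orthogonal_mx trmx1 mulmx1. Qed.

Lemma orthogonal_mxT Q : orthogonal_mx Q -> orthogonal_mx Q^T.
Proof. by rewrite /orthogonal_mx trmxK => /mulmx1C. Qed.

(** The balls of the matrix norm are squares; Euclidean discs define the same
    neighbourhoods. *)
Lemma nbhs_enormP x (A : set 'cV[R]_2) :
  nbhs x A <-> exists2 e, 0 < e & forall y, enorm (y - x) < e -> A y.
Proof.
split=> [/nbhs_ballP[e /= e0 eA]|[e e0 eA]].
  exists e => // y yx; apply: eA; split => // i j; rewrite (ord1 j).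
  rewrite /ball/= distrC.
  by have := coord_le_enorm (y - x) i; rewrite !mxE => /le_lt_trans; apply.
apply/nbhs_ballP; exists (e / 2); first by rewrite /= divr_gt0.
move=> y [_ yx]; apply: eA; apply: le_lt_trans (enorm_le_coord _) _.
have := yx ord0 ord0; have := yx ord_max ord0.
rewrite /ball/= !mxE (distrC (y _ _)) (distrC (y ord_max _)); lra.
Qed.

Lemma interior_enormP x (A : set 'cV[R]_2) :
  A° x <-> exists2 e, 0 < e & forall y, enorm (y - x) < e -> A y.
Proof. exact: nbhs_enormP. Qed.

Lemma closed_enormP (A : set 'cV[R]_2) : closed A <->
  forall x, (forall e, 0 < e -> exists2 y, A y & enorm (y - x) < e) -> A x.
Proof.
split=> [cA x Ax|cA x clx].
  apply: cA => B /nbhs_enormP[e e0 eB].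
  by have [y Ay yx] := Ax e e0; exists y; split=> //; exact: eB.
apply: cA => e e0.
have /clx[y [Ay yx]] : nbhs x [set y | enorm (y - x) < e].
  by apply/nbhs_enormP; exists e.
by exists y.
Qed.

Lemma lipschitz_continuous (T : normedModType R) (f : T -> 'cV[R]_2) (L : R) :
  (forall s t, enorm (f s - f t) <= L * `|s - t|) -> continuous f.
Proof.
move=> fL t A /nbhs_enormP[e e0 eA].
have L1 : 0 < `|L| + 1 by rewrite ltr_wpDl.
apply/nbhs_ballP; exists (e / (`|L| + 1)); first by rewrite /= divr_gt0.
move=> s; rewrite -ball_normE/= => ts; apply: eA; apply: le_lt_trans (fL _ _) _.
rewrite distrC; move: ts; rewrite ltr_pdivlMr// => /(le_lt_trans _); apply.
by rewrite mulrC ler_wpM2l// (le_trans (ler_norm _))// lerDl.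
Qed.

Lemma enorm_lipschitz_continuous (f : 'cV[R]_2 -> 'cV[R]_2) c :
  (forall s t, enorm (f s - f t) <= c * enorm (s - t)) -> continuous f.
Proof.
move=> fL t A /nbhs_enormP[e e0 eA].
have L1 : 0 < `|c| + 1 by rewrite ltr_wpDl.
apply/nbhs_enormP; exists (e / (`|c| + 1)); first by rewrite divr_gt0.
move=> s ts; apply: eA; apply: le_lt_trans (fL _ _) _.
move: ts; rewrite ltr_pdivlMr// => /(le_lt_trans _); apply.
by rewrite mulrC ler_wpM2l ?enorm_ge0// (le_trans (ler_norm _))// lerDl.
Qed.

Lemma enorm_continuous x : continuous (fun y => enorm (y - x)).
Proof.
move=> y A /nbhs_ballP[e /= e0 eA]; apply/nbhs_enormP; exists e => // z zy.
apply: eA; rewrite /ball/= ltr_norml.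
have := enorm_triangle y z x; have := enorm_triangle z y x.
rewrite (enormBC y z); lra.
Qed.

Lemma compact_closed_plane K : compact K -> closed K.
Proof. by apply: compact_closed; exact: norm_hausdorff. Qed.

Lemma compact_enorm_bounded K : compact K ->
  exists2 M, 0 < M & forall x, K x -> enorm x <= M.
Proof.
move=> cK; have : compact (enorm @` K).
  apply: continuous_compact => //; apply: continuous_subspaceT => x.
  have := @enorm_continuous 0 x; congr (continuous_at _ _).
  by apply/funext => y; rewrite subr0.
move=> /compact_bounded/ex_strict_bound_gt0[M M0 MK].
exists M => // x Kx; have := MK _ (imageP _ Kx).
by move=> /ltW; rewrite ger0_norm ?enorm_ge0.
Qed.

Lemma bounded_closed_compact_plane K M : (forall x, K x -> enorm x <= M) ->
  closed K -> compact K.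
Proof.
move=> KM cK.
pose f (v : 'rV[R]_2) : 'cV[R]_2 := v^T.
have cf : continuous f.
  apply: (@lipschitz_continuous _ _ 2) => s t.
  have le_mx (v : 'rV[R]_2) i : `|v ord0 i| <= `|v|.
    rewrite [leRHS]/Num.Def.normr /= mx_normrE; apply/bigmax_geP; right => /=.
    by exists (ord0, i).
  apply: le_trans (enorm_le_coord _) _; rewrite !mxE.
  have := le_mx (s - t) ord0; have := le_mx (s - t) ord_max.
  rewrite !mxE; lra.
have cB := @rV_compact _ _ (fun=> `[- M, M]%classic) (fun=> @segment_compact _ _ _).
have := continuous_compact (continuous_subspaceT cf) (cB 2%N).
move/(subclosed_compact cK); apply => x Kx.
exists x^T; last by rewrite /f trmxK.
move=> i /=; rewrite in_itv/= -ler_norml mxE.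
exact: le_trans (coord_le_enorm _ _) (KM _ Kx).
Qed.

End Euclid.

(** * Projection to a compact convex set *)

Section Convex.
Context {R : realType}.
Implicit Types (x y z p u v w a : 'cV[R]_2) (Q : 'M[R]_2) (S F K : set 'cV[R]_2).

Definition convex_plane K := forall x y (t : R), K x -> K y -> 0 <= t <= 1 ->
  K (t *: x + (1 - t) *: y).

Lemma convex_planeP K :
  convex_set (K : set (convex_lmodType 'cV[R]_2)) <-> convex_plane K.
Proof.
split=> [cK x y t Kx Ky /andP[t0 t1]|cK x y l /set_mem Kx /set_mem Ky].
  have := cK x y (Itv01 t0 t1) (mem_set Kx) (mem_set Ky).
  by move/set_mem.
by apply/mem_set; apply: cK => //; rewrite ge0 le1.
Qed.

(** The inner parallel body of [F] at distance [e]. For a convex body it is again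
    compact and convex, and can stand in for the open set [F°]: a compact set lies
    in [F°] exactly when it lies in [inset F e] for some [e > 0]. *)
Definition inset F (e : R) : set 'cV[R]_2 :=
  [set x | forall w, enorm w <= e -> F (x + w)].

Lemma inset_sub F e : 0 <= e -> inset F e `<=` F.
Proof. by move=> e0 x /(_ 0); rewrite enorm0 addr0; exact. Qed.

Lemma inset_interior F e : 0 < e -> inset F e `<=` F°.
Proof.
move=> e0 x Fx; apply/interior_enormP; exists e => // y /ltW yx.
by rewrite -(subrK x y) addrC; exact: Fx.
Qed.

Lemma inset_convex F e : convex_plane F -> convex_plane (inset F e).
Proof.
move=> cF x y t Fx Fy t01 w we.
rewrite (_ : _ + w = t *: (x + w) + (1 - t) *: (y + w)); last first.
  by apply/matrixP => i j; rewrite !mxE; ring.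
by apply: cF => //; [exact: Fx|exact: Fy].
Qed.

Lemma inset_compact F e : 0 <= e -> compact F -> compact (inset F e).
Proof.
move=> e0 cF; apply: (subclosed_compact _ cF (inset_sub e0)).
apply/closed_enormP => x clx w we.
move/compact_closed_plane/closed_enormP : cF; apply => d d0.
have [y Fy yx] := clx d d0; exists (y + w); first exact: Fy.
by rewrite opprD addrACA subrr addr0.
Qed.

(** Around each point of [S] a whole disc lies in [F]; compactness makes its
    radius uniform. *)
Lemma compact_sub_inset S F : compact S -> S `<=` F° ->
  exists2 e, 0 < e & S `<=` inset F e.
Proof.
move=> /compact_near_coveringP cS SF.
have : \forall e \near (0 : R)^'+, S `<=` inset F e.
  apply: cS => x /SF/interior_enormP[d d0 dF].
  exists ([set y | enorm (y - x) < d / 2], [set e | e < d / 2]).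
    split=> /=; first by apply/nbhs_enormP; exists (d / 2); rewrite ?divr_gt0.
    by apply: nbhs_right_lt; rewrite divr_gt0.
  move=> [y e] /= [yx ed] w we; apply: dF; rewrite addrAC.
  apply: le_lt_trans (enormD _ _) _; lra.
move=> H; near (0 : R)^'+ => e; exists e; first by [].
by near: e.
Unshelve. all: by end_near. Qed.

(** The variational characterisation of the point of a convex set [K] nearest to
    [x]: no point of [K] is seen from [p] at an acute angle with [x]. *)
Definition is_projection K x p := K p /\ forall z, K z -> dot (x - p) (z - p) <= 0.

Lemma dot_subZ u w (t : R) : dot (u - t *: w) (u - t *: w) =
  dot u u - 2 * t * dot u w + t ^+ 2 * dot w w.
Proof. by rewrite !dot_lin (dotC w u); ring. Qed.

(** Minimality of [enorm (x - p)] against the points of the segment from [p] to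
    [z] near [p] forces the angle at [p] to be obtuse. *)
Lemma projection_exists K x : compact K -> convex_plane K -> K !=set0 ->
  exists p, is_projection K x p.
Proof.
move=> cK vK K0.
have [p /set_mem Kp minp] := compact_EVT_min K0 cK
  (continuous_subspaceT (@enorm_continuous _ x)).
exists p; split => // z Kz; rewrite leNgt; apply/negP => posd.
set d := dot _ _ in posd; set n := dot (z - p) (z - p).
have n0 : 0 <= n by exact: dot_ge0.
(* Moving from [p] a fraction [t] of the way to [z] changes the squared distance
   to [x] by [t * (t * n - 2 * d)], which is negative for this [t] since
   [t * n <= d]. *)
pose t := d / (d + n).
have dn : 0 < d + n by lra.
have t01 : 0 <= t <= 1.
  by rewrite divr_ge0 ?(ltW posd, ltW dn)//= ler_pdivrMr// mul1r; lra.
have := minp _ (mem_set (vK z p t Kz Kp t01)).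
rewrite (_ : _ + _ - x = - ((x - p) - t *: (z - p))); last first.
  by apply/matrixP => i j; rewrite !mxE; ring.
rewrite (enormBC p) enormN enorm_leP ?enorm_ge0// enorm_sqr dot_subZ -/d -/n.
have td : t * (d + n) = d by rewrite /t divfK// gt_eqF.
have t0 : 0 < t by rewrite divr_gt0.
nra.
Qed.

(** Adding the two obtuse-angle inequalities gives
    [|p - p'|^2 <= <x - x', p - p'>]. *)
Lemma projection_lipschitz K x x' p p' :
  is_projection K x p -> is_projection K x' p' ->
  enorm (p - p') <= enorm (x - x').
Proof.
move=> [Kp Hp] [Kp' Hp'].
have h1 := Hp _ Kp'; have h2 := Hp' _ Kp.
have : enorm (p - p') ^+ 2 <= enorm (x - x') * enorm (p - p').
  rewrite enorm_sqr; apply: le_trans (dot_le_enorm _ _).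
  move: h1 h2; rewrite !dot_lin !opprK.
  have := dotC p p'; lra.
have [->|n0] := eqVneq (enorm (p - p')) 0; first by rewrite enorm_ge0.
by rewrite expr2 ler_pM2r// lt_neqAle eq_sym n0 enorm_ge0.
Qed.

(** A point of [K] where a linear form is maximal is the projection of the whole
    ray leaving it along the gradient of the form. *)
Lemma outward_projection K m v (s : R) : K m -> 0 <= s ->
  (forall z, K z -> dot v z <= dot v m) -> is_projection K (m + s *: v) m.
Proof.
move=> Km s0 mv; split=> // z Kz.
rewrite addrAC subrr add0r dotZl mulr_ge0_le0// dotDr dotNr subr_le0.
exact: mv.
Qed.

Lemma ray_meets_circle (q v : 'cV[R]_2) (r : R) : v != 0 -> enorm q <= r ->
  exists2 s, 0 <= s & enorm (q + s *: v) = r.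
Proof.
move=> v0 qr; have r0 : 0 <= r := le_trans (enorm_ge0 _) qr.
have vv : 0 < dot v v := dot_gt0 v0.
move: qr; rewrite enorm_leP// => qr.
set A := dot v v in vv; set B := dot q v; set C := dot q q in qr.
(* [s] is the nonnegative root of [A * s ^+ 2 + 2 * B * s + C = r ^+ 2]. *)
pose D := B ^+ 2 + A * (r ^+ 2 - C).
have D0 : B ^+ 2 <= D by rewrite lerDl mulr_ge0 ?(ltW vv)// subr_ge0.
have D00 : 0 <= D := le_trans (sqr_ge0 _) D0.
have BD : `|B| <= Num.sqrt D by rewrite -sqrtr_sqr ler_sqrt.
exists ((Num.sqrt D - B) / A).
  by rewrite divr_ge0 ?(ltW vv)// subr_ge0 (le_trans (ler_norm _)).
apply/eqP; rewrite -(@eqrXn2 _ 2)// ?enorm_ge0//; apply/eqP.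
rewrite enorm_sqr !dot_lin (dotC v q) -/A -/B -/C.
have : Num.sqrt D ^+ 2 = D by rewrite sqr_sqrtr.
move: (Num.sqrt D) => e; rewrite /D => eD.
transitivity (C + (e ^+ 2 - B ^+ 2) / A); last by rewrite eD; field; rewrite gt_eqF.
by field; rewrite gt_eqF.
Qed.

Lemma dot_continuous v : continuous (dot v).
Proof.
move=> z A /nbhs_ballP[e /= e0 eA]; apply/nbhs_enormP.
exists (e / (enorm v + 1)); first by rewrite divr_gt0// ltr_wpDl// enorm_ge0.
move=> y; rewrite ltr_pdivlMr; last by rewrite ltr_wpDl// enorm_ge0.
move=> yz; apply: eA; rewrite /ball/=.
have -> : dot v z - dot v y = dot v (z - y) by rewrite !dot_lin.
have h1 := dot_le_enorm v (z - y); have h2 := dot_le_enorm v (- (z - y)).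
rewrite dotNr enormN in h2.
move: yz h1 h2; rewrite (enormBC z y) mulrDr mulr1 mulrC => yz h1 h2.
have := enorm_ge0 (y - z).
rewrite ltr_norml; lra.
Qed.

(** A linear form separating a point of [K] from [H] would be maximal on [K] at
    some [m] outside [H]. But the outward normal ray at [m] crosses the circle,
    and the crossing point projects to [m]. *)
Lemma circle_projections_hull K H s (r : R) : compact K ->
  (forall x, K x -> enorm (x - s) <= r) ->
  compact H -> convex_plane H -> H !=set0 ->
  (forall q p, enorm (q - s) = r -> is_projection K q p -> H p) -> K `<=` H.
Proof.
move=> cK Kr cH vH H0 projH x Kx; apply: contrapT => nHx.
have [p [Hp xp]] := projection_exists x cH vH H0.
move vE : (x - p) => v in xp.
have v0 : v != 0.
  by apply: contra_notN nHx; rewrite -vE subr_eq0 => /eqP ->.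
have [m /set_mem Km maxm] := compact_EVT_max (ex_intro _ x Kx) cK
  (continuous_subspaceT (@dot_continuous v)).
have {}maxm z : K z -> dot v z <= dot v m by move=> /mem_set/maxm.
have [t t0 tr] := ray_meets_circle v0 (Kr _ Km).
have Hm : H m.
  apply: (projH (m + t *: v)); first by rewrite -tr addrAC.
  exact: outward_projection.
have := maxm _ Kx; have := xp _ Hm.
have := dot_gt0 v0.
rewrite -{2}vE !dot_lin; lra.
Qed.

End Convex.

(** * Diameter, ball hulls and circles *)

Section Diameter.
Context {R : realType}.
Implicit Types (x y z p u v w a : 'cV[R]_2) (Q : 'M[R]_2) (S F K : set 'cV[R]_2).

Lemma diam_ge S x y : compact S -> S x -> S y -> enorm (x - y) <= diam S.
Proof.
move=> /compact_enorm_bounded[M M0 MS] Sx Sy; apply: sup_upper_bound.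
  split; first by exists (enorm (x - y)), x => //; exists y.
  exists (M + M) => _ [u Su [v Sv <-]].
  by apply: le_trans (enormD _ _) _; rewrite enormN lerD ?MS.
by exists x => //; exists y.
Qed.

Lemma diam_empty S : ~ (S !=set0) -> diam S = 0.
Proof.
move=> S0; rewrite /diam (_ : [set _ | _ in _ & _ in _] = set0) ?sup0//.
by apply/seteqP; split=> // z [u Su _]; apply: S0; exists u.
Qed.

Lemma diam_le S (d : R) : 0 <= d ->
  (forall x y, S x -> S y -> enorm (x - y) <= d) -> diam S <= d.
Proof.
move=> d0 Sd; have [[x Sx]|S0] := pselect (S !=set0).
  apply: ge_sup; first by exists (enorm (x - x)), x => //; exists x.
  by move=> _ [u Su [v Sv <-]]; exact: Sd.
by rewrite diam_empty.
Qed.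

Lemma diam_ge0 S : compact S -> 0 <= diam S.
Proof.
move=> cS; have [[x Sx]|S0] := pselect (S !=set0).
  exact: le_trans (enorm_ge0 _) (diam_ge cS Sx Sx).
by rewrite diam_empty.
Qed.

(** The intersection of all discs of radius [d] that contain [S]. It serves in
    place of the convex hull: closedness and convexity are inherited from discs,
    and its diameter is at most [d] as soon as that of [S] is. *)
Definition ball_hull S (d : R) : set 'cV[R]_2 :=
  [set x | forall y, (forall z, S z -> enorm (y - z) <= d) -> enorm (x - y) <= d].

Lemma sub_ball_hull S d : S `<=` ball_hull S d.
Proof. by move=> x Sx y; rewrite enormBC; apply. Qed.

Lemma ball_hull_convex S d : convex_plane (ball_hull S d).
Proof.
move=> x y t Sx Sy /andP[t0 t1] z zS.
rewrite (_ : _ - z = t *: (x - z) + (1 - t) *: (y - z)); last first.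
  by apply/matrixP => i j; rewrite !mxE; ring.
apply: le_trans (enormD _ _) _; rewrite !enormZ !ger0_norm ?subr_ge0//.
have := Sx _ zS; have := Sy _ zS; nra.
Qed.

(** Points of [S] are centres of discs containing [S], so a point [y] of the hull
    is within [d] of all of [S]; it is then itself such a centre, and every other
    point [x] of the hull is within [d] of it. *)
Lemma ball_hull_diam S (d : R) x y :
  (forall u v, S u -> S v -> enorm (u - v) <= d) ->
  ball_hull S d x -> ball_hull S d y -> enorm (x - y) <= d.
Proof. by move=> Sd Sx Sy; apply: Sx => z Sz; apply: Sy => u; exact: Sd. Qed.

Lemma ball_hull_compact S (d : R) : S !=set0 ->
  (forall u v, S u -> S v -> enorm (u - v) <= d) -> compact (ball_hull S d).
Proof.
move=> [s Ss] Sd; apply: (@bounded_closed_compact_plane _ _ (d + enorm s)).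
  move=> x /(_ s (Sd _ ^~ Ss)) xs; rewrite -(subrK s x).
  by apply: le_trans (enormD _ _) _; rewrite lerD2r.
apply/closed_enormP => x clx y yS; apply/ler_addgt0Pl => e e0.
have [z Sz /ltW zx] := clx e e0.
apply: le_trans (enorm_triangle z _ _) _.
by rewrite enormBC lerD// Sz.
Qed.

Definition circle (r t : R) : 'cV[R]_2 :=
  \col_i (if i == ord0 then r * cos (pi *+ 2 * t) else r * sin (pi *+ 2 * t)).

Lemma deriv_le1_lipschitz (f df : R -> R) :
  (forall c : R, is_derive c 1 f (df c)) -> (forall c : R, `|df c| <= 1) ->
  forall s t : R, `|f s - f t| <= `|s - t|.
Proof.
move=> fdf df1.
have cf : continuous f.
  by move=> c; apply/differentiable_continuous/derivable1_diffP.
suff H (s t : R) : s <= t -> `|f t - f s| <= `|t - s|.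
  move=> s t; have [st|/ltW ts] := leP s t; last exact: H.
  by rewrite distrC (distrC s); exact: H.
move=> st.
have [|c _ ->] := @MVT_segment R f df s t st (fun c _ => fdf c).
  exact: continuous_subspaceT.
by rewrite normrM ler_piMl.
Qed.

Lemma circle_lipschitz (r s t : R) : 0 <= r ->
  enorm (circle r s - circle r t) <= 4 * pi * r * `|s - t|.
Proof.
move=> r0; apply: le_trans (enorm_le_coord _) _; rewrite !mxE/= -!mulrBr.
rewrite !normrM (ger0_norm r0) -mulrDr.
have hc : `|cos (pi *+ 2 * s) - cos (pi *+ 2 * t)| <= `|pi *+ 2 * s - pi *+ 2 * t :> R|.
  apply: (@deriv_le1_lipschitz _ (fun c : R => - sin c)) => c.
  by rewrite normrN ler_norml sin_geN1 sin_le1.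
have hs : `|sin (pi *+ 2 * s) - sin (pi *+ 2 * t)| <= `|pi *+ 2 * s - pi *+ 2 * t :> R|.
  apply: (@deriv_le1_lipschitz _ (@cos R)) => c.
  by rewrite ler_norml cos_geN1 cos_le1.
move: hc hs; rewrite -mulrBr normrM (@ger0_norm _ (pi *+ 2)); last first.
  by rewrite mulrn_wge0// pi_ge0.
move=> hc hs; rewrite (_ : 4 * pi * r * _ = r * (4 * pi * `|s - t|)); last by ring.
apply: ler_wpM2l => //; move: hc hs; lra.
Qed.

Lemma circle_surj (r : R) q : 0 < r -> enorm q = r ->
  exists2 t, t \in `[0, 1] & circle r t = q.
Proof.
move=> r0 qr.
have p2 : 0 < pi *+ 2 :> R by rewrite mulr2n addr_gt0 ?pi_gt0.
have := enorm_sqr q; rewrite qr dotE -!expr2.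
set x := q ord0 ord0; set y := q ord_max ord0 => rE.
have xr : -1 <= x / r <= 1.
  have := coord_le_enorm q ord0; rewrite qr ler_norml -/x.
  by rewrite ler_pdivlMr// ler_pdivrMr// mulN1r mul1r.
(* [acos] gives the angle of a point of the upper half-circle; the lower half is
   its mirror image. *)
pose th := acos (x / r).
have th0 : 0 <= th by exact: acos_ge0.
have thpi : th <= pi by exact: acos_lepi.
have cth : r * cos th = x by rewrite acosK ?in_itv//= mulrC divfK ?gt_eqF.
have sth : r * sin th = `|y|.
  rewrite sin_acos// -{1}(ger0_norm (ltW r0)) -sqrtr_sqr -sqrtrM ?sqr_ge0//.
  rewrite -sqrtr_sqr; congr Num.sqrt; rewrite mulrBr mulr1 expr_div_n.
  by rewrite mulrC divfK ?expf_neq0 ?gt_eqF// rE addrAC subrr add0r.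
have mk t' : r * cos (pi *+ 2 * t') = x -> r * sin (pi *+ 2 * t') = y ->
    circle r t' = q.
  by move=> cx sy; apply/colP; apply: ord2_ind; rewrite mxE/=.
have [y0|y0] := leP 0 y.
  exists (th / (pi *+ 2)).
    rewrite in_itv/= divr_ge0 ?(ltW p2)//=.
    by rewrite ler_pdivrMr// mul1r mulr2n ler_wpDl// pi_ge0.
  have E : pi *+ 2 * (th / (pi *+ 2)) = th.
    by rewrite mulrC divfK// gt_eqF.
  by apply: mk; rewrite E; [exact: cth|rewrite sth ger0_norm].
exists (1 - th / (pi *+ 2)).
  rewrite in_itv/= subr_ge0 gerBl divr_ge0 ?(ltW p2)//= andbT.
  by rewrite ler_pdivrMr// mul1r mulr2n ler_wpDl// pi_ge0.
have E : pi *+ 2 * (1 - th / (pi *+ 2)) = - th + pi *+ 2.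
  by rewrite mulrBr mulr1 [_ * (_ / _)]mulrC divfK ?gt_eqF// addrC.
apply: mk; rewrite E; first by rewrite cosD2pi cosN.
by rewrite sinD2pi sinN mulrN sth ltr0_norm// opprK.
Qed.

End Diameter.

(** * Escape loops *)

Section Paths.
Context {R : realType}.
Implicit Types (x y z p u v w a : 'cV[R]_2) (Q : 'M[R]_2) (S F K : set 'cV[R]_2)
  (gamma : R -> 'cV[R]_2).

Definition lipschitz_loop (L r : R) gamma :=
  [/\ forall s t, enorm (gamma s - gamma t) <= L * `|s - t|,
      forall t, enorm (gamma t) <= r & gamma 0 = gamma 1].

Lemma lipschitz_loop_closed_path L r gamma :
  lipschitz_loop L r gamma -> closed_path gamma.
Proof.
move=> [gL _ g01]; split=> //; apply: continuous_subspaceT.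
exact: lipschitz_continuous gL.
Qed.

(** The Lipschitz bounds on the edges of an inscribed polygon telescope. *)
Lemma lipschitz_loop_rectifiable L r gamma :
  lipschitz_loop L r gamma -> rectifiable gamma.
Proof.
move=> [gL _ _]; exists L => _ [s sp <-]; rewrite /polygonal_length.
set t := nth 1 (0 :: s).
have tS i : (i < size s)%N -> t i <= t i.+1.
  by case: sp => /(pathP 1) sp _ /sp /ltW.
apply: (@le_trans _ _ (\sum_(0 <= i < size s) (L * t i.+1 - L * t i))).
  apply: ler_sum_nat => i /andP[_ /tS ti]; rewrite -mulrBr.
  by rewrite -[X in L * X]ger0_norm ?subr_ge0.
rewrite telescope_sumr// -mulrBr /t [nth _ _ 0]/= subr0.
case: sp => _ /eqP; rewrite -[size s]/(size (0 :: s)).-1 nth_last/= => ->.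
by rewrite mulr1.
Qed.

Lemma trace_compact gamma : closed_path gamma -> compact (trace gamma).
Proof. by move=> [cg _]; apply: continuous_compact => //; exact: segment_compact. Qed.

Lemma covers_empty F S : ~ (S !=set0) -> covers F S.
Proof.
move=> S0; exists 0, 1%:M; split; first exact: orthogonal_mx1.
by move=> w [x Sx _]; case: S0; exists x.
Qed.

Lemma rigid_copy_compact a Q S : orthogonal_mx Q -> compact S ->
  compact (rigid_copy a Q S).
Proof.
move=> oQ cS; apply: continuous_compact => //; apply: continuous_subspaceT.
apply: (@enorm_lipschitz_continuous _ _ 1) => x y.
by rewrite opprD addrACA subrr add0r -mulmxBr enorm_orthogonal// mul1r.
Qed.

(** The loop is the projection to the ball hull [K] of [S] of a circle around
    [S]. Projection is 1-Lipschitz, so the Lipschitz constant is that of the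
    circle whatever [S] is, which gives the compactness needed to pass to the
    limit. The loop stays in [K], hence has diameter at most [d]; and if a copy of
    it fits in the open convex set [F°], so does the same copy of [K]. *)
Lemma escape_loop_of_compact F S (d r : R) : compact F -> convex_plane F ->
  compact S -> (forall x y, S x -> S y -> enorm (x - y) <= d) ->
  0 < r -> d <= r -> ~ covers F° S ->
  exists gamma, [/\ lipschitz_loop (4 * pi * r) r gamma,
    forall s t, enorm (gamma s - gamma t) <= d & escape_path F gamma].
Proof.
move=> cF vF cS Sd r0 dr nS.
have [s Ss] : S !=set0.
  by apply: contrapT => S0; apply: nS; exact: covers_empty.
pose K := ball_hull S d.
have SK : S `<=` K := @sub_ball_hull _ _ _.
have cK : compact K by apply: ball_hull_compact => //; exists s.
have vK : convex_plane K := @ball_hull_convex _ _ _.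
have K0 : K !=set0 by exists s; exact: SK.
have Kd x y : K x -> K y -> enorm (x - y) <= d by exact: ball_hull_diam.
have /choice[P PK] : forall x, exists p, is_projection K x p.
  by move=> x; exact: projection_exists.
(* The translation by [- s] makes the bound [r] on the loop independent of the
   position of [S]. *)
pose gamma t := P (s + circle r t) - s.
have loop : lipschitz_loop (4 * pi * r) r gamma.
  split=> [t u|t|].
  - rewrite opprB addrA subrK; apply: le_trans (projection_lipschitz (PK _) (PK _)) _.
    by rewrite opprD addrACA subrr add0r circle_lipschitz// ltW.
  - by apply: le_trans dr; apply: Kd; [case: (PK (s + circle r t))|exact: SK].
  - congr (P (s + _) - s); apply/colP => i.
    by rewrite !mxE mulr0 mulr1 cos0 sin0 cos2pi sin2pi.
exists gamma; split=> //.
  move=> t u; rewrite opprB addrA subrK.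
  by apply: Kd; case: (PK (s + circle r t)) (PK (s + circle r u)) => ? _ [].
have cg := lipschitz_loop_closed_path loop.
split=> // a Q oQ aQF; apply: nS.
have cT := @rigid_copy_compact a Q _ oQ (trace_compact cg).
have [e e0 aQFe] := compact_sub_inset cT aQF.
(* The preimage of [inset F e] under [x |-> a + Q (x - s)], written as a rigid copy
   so that its compactness is inherited. *)
pose H := rigid_copy (s - Q^T *m a) Q^T (inset F e).
have HE x : H x <-> inset F e (a + Q *m (x - s)).
  have oQT : Q^T *m Q = 1%:M by apply: mulmx1C.
  split=> [[y Fy <-]|Fx].
    rewrite (_ : _ - s = Q^T *m (y - a)).
      by rewrite mulmxA oQ mul1mx addrC subrK.
    by rewrite mulmxBr addrC addrA addrA addNr add0r addrC.
  exists (a + Q *m (x - s)) => //.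
  rewrite mulmxDr mulmxA oQT mul1mx addrA subrK.
  by rewrite addrC subrK.
have cH : compact H.
  apply: rigid_copy_compact; first exact: orthogonal_mxT.
  by apply: inset_compact => //; exact: ltW.
have vH : convex_plane H.
  move=> x y t /HE Hx /HE Hy t01; apply/HE.
  rewrite (_ : a + _ = t *: (a + Q *m (x - s)) + (1 - t) *: (a + Q *m (y - s))).
    exact: inset_convex.
  rewrite [in LHS](_ : _ - s = t *: (x - s) + (1 - t) *: (y - s)); last first.
    by apply/matrixP => i j; rewrite !mxE; ring.
  rewrite mulmxDr -!scalemxAr.
  by apply/matrixP => i j; rewrite !mxE; ring.
have traceH t : t \in `[0, 1] -> H (P (s + circle r t)).
  by move=> t01; apply/HE; apply: aQFe; exists (gamma t) => //; exists t.
have KH : K `<=` H.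
  apply: (@circle_projections_hull _ _ _ s r) => //.
  - by move=> x Kx; apply: le_trans dr; apply: Kd => //; exact: SK.
  - by exists (P (s + circle r 0)); apply: traceH; rewrite in_itv/= lexx ler01.
  - move=> q p qr pq; have [t t01 tq] := circle_surj r0 qr.
    rewrite (_ : p = P (s + circle r t)); first exact: traceH.
    apply/eqP; rewrite -subr_eq0; apply/eqP/enorm0_eq0/eqP.
    rewrite eq_le enorm_ge0 andbT.
    apply: le_trans (projection_lipschitz pq (PK _)) _.
    by rewrite tq [s + _]addrC subrK subrr enorm0.
exists (a - Q *m s), Q; split=> // _ [x Sx <-]; apply: (inset_interior e0).
have /HE : H x by exact/KH/SK.
by rewrite mulmxBr addrA addrAC.
Qed.

End Paths.

(** * Cluster points of bounded sequences of functions *)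

Section Limits.
Context {R : realType}.

(** Tychonoff gives the sequence a cluster point for pointwise convergence. *)
Lemma pointwise_cluster (I : eqType) (M : R) (g : nat -> I -> R) :
  (forall n i, `|g n i| <= M) ->
  exists f : I -> R, forall (s : seq I) (e : R) (N : nat), 0 < e ->
    exists2 n, (N <= n)%N & forall i, i \in s -> `|g n i - f i| < e.
Proof.
move=> gM.
have cM := @tychonoff I (fun=> R) (fun=> `[- M, M]%classic)
  (fun=> @segment_compact _ _ _).
have [|f [_ clf]] := cM (g @ \oo) _.
  by exists 0%N => // n _ i /=; rewrite in_itv/= -ler_norml.
exists f => s e N e0.
have gN : (g @ \oo) (g @` [set n | (N <= n)%N]).
  by exists N => // n /= Nn; exists n.
have fs : nbhs (f : prod_topology (fun=> R))
    [set h | forall i, i \in s -> `|h i - f i| < e].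
  have Ff := @nbhs_filter (prod_topology (fun _ : I => R)) f.
  elim: s => [|i s IHs].
    apply: (@filterS _ _ Ff setT); last exact: (@filterT _ _ Ff).
    by move=> h _ i; rewrite in_nil.
  have fi : nbhs (f : prod_topology (fun=> R)) [set h | `|h i - f i| < e].
    have := @proj_continuous I (fun=> R) i f.
    move=> /(_ [set c | `|c - f i| < e]); apply.
    apply/nbhs_ballP; exists e => // c; rewrite /ball/= distrC; exact.
  apply: (@filterS _ _ Ff _ _ _ (@filterI _ _ Ff _ _ fi IHs)).
  move=> h [hi hs] j; rewrite in_cons => /predU1P[->//|].
  exact: hs.
by have [_ [[n Nn <-] gs]] := clf _ _ gN fs; exists n.
Qed.

(** The multiples of [1 / n], for an integer [n > 1 / e]. *)
Lemma unit_interval_net (e : R) : 0 < e -> exists s : seq R,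
  forall t : R, t \in `[0, 1] -> exists2 u, u \in s & `|t - u| <= e.
Proof.
move=> e0; pose n := (Num.truncn e^-1).+1.
exists [seq k%:R / n%:R | k <- iota 0 n.+1] => t; rewrite in_itv => /andP[t0 t1].
have n0 : 0 < n%:R :> R by rewrite ltr0n.
have ne : e^-1 < n%:R by exact: truncnS_gt.
have tn0 : 0 <= t * n%:R by rewrite mulr_ge0// ltW.
exists ((Num.truncn (t * n%:R))%:R / n%:R).
  apply: (map_f (fun k : nat => k%:R / n%:R)); rewrite mem_iota add0n/= ltnS.
  rewrite -(ler_nat R); apply: (@le_trans _ _ (t * n%:R)).
    by rewrite truncn_le.
  by rewrite ler_piMl// ltW.
have : (Num.truncn (t * n%:R))%:R <= t * n%:R by rewrite truncn_le.
have := truncnS_gt (t * n%:R).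
set k := _%:R; move=> h1 h2.
rewrite -(@ler_pM2r _ n%:R)// -{1}(@ger0_norm _ n%:R) ?(ltW n0)// -normrM.
rewrite mulrBl divfK ?gt_eqF//.
rewrite ger0_norm ?subr_ge0//.
have : 1 <= e * n%:R by rewrite mulrC -ler_pdivrMr// mul1r ltW.
move: h1; rewrite -natr1 /k; lra.
Qed.

End Limits.

(** * The critical escape diameter *)

Section Critical.
Context {R : realType}.
Implicit Types (x y z p u v w a : 'cV[R]_2) (Q : 'M[R]_2) (S F K : set 'cV[R]_2)
  (gamma : R -> 'cV[R]_2).

Lemma plane_cluster (I : eqType) (M : R) (g : nat -> I -> 'cV[R]_2) :
  (forall n i, enorm (g n i) <= M) ->
  exists f : I -> 'cV[R]_2, forall (s : seq I) (e : R) (N : nat), 0 < e ->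
    exists2 n, (N <= n)%N & forall i, i \in s -> enorm (g n i - f i) < e.
Proof.
move=> gM; have [|h hP] := @pointwise_cluster R (I * 'I_2)%type M
    (fun n ij => g n ij.1 ij.2 ord0).
  by move=> n [i j]; exact: le_trans (coord_le_enorm _ _) (gM _ _).
exists (fun i => \col_j h (i, j)) => s e N e0.
have [|n Nn hn] := hP [seq (i, j) | i <- s, j <- enum 'I_2] (e / 2) N.
  by rewrite divr_gt0.
exists n => // i si; apply: le_lt_trans (enorm_le_coord _) _; rewrite !mxE.
have hj j : `|g n i j ord0 - h (i, j)| < e / 2.
  by apply: (hn (i, j)); apply/allpairsP; exists (i, j); rewrite mem_enum.
have := hj ord0; have := hj ord_max; lra.
Qed.

Lemma natSinv_small (e : R) : 0 < e ->
  exists N, forall n, (N <= n)%N -> n.+1%:R^-1 < e.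
Proof.
move=> e0; have [N _ NP] := near_infty_natSinv_lt (PosNum e0).
by exists N => n Nn; exact: NP.
Qed.

(** A pointwise cluster point of equi-Lipschitz loops is uniformly close to some
    of them, as comparison on a finite net shows; so if a copy of it lay in the
    open set [F°], hence at positive distance from the complement of [F], the
    same copy of some loop of the sequence would lie there too. *)
Lemma escape_loop_limit F (L r d : R) (g : nat -> R -> 'cV[R]_2) :
  compact F ->
  (forall n, [/\ lipschitz_loop L r (g n),
    forall s t, enorm (g n s - g n t) <= d + n.+1%:R^-1
    & escape_path F (g n)]) ->
  exists gamma, [/\ lipschitz_loop L r gamma,
    forall s t, enorm (gamma s - gamma t) <= d & escape_path F gamma].
Proof.
move=> cF gP.
have gL n s t : enorm (g n s - g n t) <= L * `|s - t| by case: (gP n) => -[].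
have gr n t : enorm (g n t) <= r by case: (gP n) => -[].
have [gamma gammaP] := plane_cluster gr.
have close s t (e : R) N : 0 < e -> exists n, [/\ (N <= n)%N,
    enorm (gamma s - g n s) < e & enorm (gamma t - g n t) < e].
  move=> e0; have [n Nn sn] := gammaP [:: s; t] e N e0; exists n; split=> //.
    by rewrite enormBC sn// mem_head.
  by rewrite enormBC sn// in_cons mem_head orbT.
have e2 (e : R) : 0 < e -> 0 < e / 2 by move=> e0; rewrite divr_gt0.
have lip s t : enorm (gamma s - gamma t) <= L * `|s - t|.
  apply/ler_addgt0Pl => e e0; have [n [_ hs ht]] := close s t _ 0%N (e2 _ e0).
  have := gL n s t; have := enorm_triangle (g n s) (gamma s) (gamma t).
  have := enorm_triangle (g n t) (g n s) (gamma t).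
  rewrite (enormBC (g n t) (gamma t)); lra.
have loop : lipschitz_loop L r gamma.
  split=> // [t|].
    apply/ler_addgt0Pl => e e0; have [n [_ hs _]] := close t t _ 0%N e0.
    have := gr n t; have := enormD (gamma t - g n t) (g n t).
    rewrite subrK; lra.
  apply/eqP; rewrite -subr_eq0; apply/eqP/enorm0_eq0/eqP.
  rewrite eq_le enorm_ge0 andbT; apply/ler_addgt0Pl => e e0.
  have [n [_ hs ht]] := close 0 1 _ 0%N (e2 _ e0).
  have [[_ _ gn01] _ _] := gP n.
  have := enorm_triangle (g n 0) (gamma 0) (gamma 1).
  rewrite {2}gn01 (enormBC (g n 1)); lra.
exists gamma; split=> //.
  move=> s t; apply/ler_addgt0Pl => e e0.
  have e3 : 0 < e / 3 by rewrite divr_gt0.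
  have [N NP] := natSinv_small e3.
  have [n [/NP Nn hs ht]] := close s t _ N e3.
  have [_ gd _] := gP n.
  move: Nn (gd s t); move: (n.+1%:R^-1) => q qe.
  have := enorm_triangle (g n s) (gamma s) (gamma t).
  have := enorm_triangle (g n t) (g n s) (gamma t).
  rewrite (enormBC (g n t) (gamma t)); lra.
have cg := lipschitz_loop_closed_path loop.
split=> // a Q oQ aQF.
have cT := @rigid_copy_compact _ a Q _ oQ (trace_compact cg).
have [e e0 aQFe] := compact_sub_inset cT aQF.
have L0 : 0 <= L.
  have := le_trans (enorm_ge0 _) (gL 0%N 1 0).
  by rewrite subr0 normr1 mulr1.
(* The budget [e / 2] is shared equally by three errors: the variation of [g n] over one
   mesh, the distance on the net, the variation of [gamma] over one mesh. *)
pose dl := e / (6 * (L + 1)).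
have dl0 : 0 < dl by rewrite divr_gt0// mulr_gt0// ltr_wpDl.
have Ldl : L * dl <= e / 6.
  rewrite /dl mulrA ler_pdivrMr ?mulr_gt0 ?ltr_wpDl//.
  have := ltW e0; nra.
have [net netP] := unit_interval_net dl0.
have e6 : 0 < e / 6 by rewrite divr_gt0.
have [n _ nP] := gammaP net _ 0%N e6.
have gnt t : t \in `[0, 1] -> enorm (g n t - gamma t) <= e / 2.
  move=> /netP[u /nP un tu].
  have h1 := enorm_triangle (g n u) (g n t) (gamma t).
  have h2 := enorm_triangle (gamma u) (g n u) (gamma t).
  have h3 := gL n t u; have h4 := lip u t.
  have h5 : L * `|t - u| <= L * dl by rewrite ler_wpM2l.
  rewrite (distrC u) in h4.
  lra.
have [_ _ [_ /(_ a Q oQ)]] := gP n; apply => _ [_ [t t01 <-] <-].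
apply: (@inset_interior _ _ (e / 2)); first exact: e2.
move=> w we.
rewrite (_ : _ + w = (a + Q *m gamma t) + (Q *m (g n t - gamma t) + w)); last first.
  rewrite mulmxBr; move: (Q *m _) (Q *m _) => A B.
  by apply/matrixP => i j; rewrite !mxE; ring.
apply: (aQFe (a + Q *m gamma t)).
  by exists (gamma t) => //; exists t.
apply: le_trans (enormD _ _) _; rewrite enorm_orthogonal//.
have := gnt t t01; lra.
Qed.

(** A set of diameter less than the radius of a disc in [F] fits in that disc, with
    any of its points moved to the centre. *)
Lemma covers_small F : convex_body F -> exists2 d, 0 < d &
  forall S, compact S -> diam S < d -> covers F° S.
Proof.
move=> [_ _ [p /interior_enormP[r r0 rF]]]; exists r => // S cS Sr.
have [[s Ss]|/covers_empty] := pselect (S !=set0); last exact.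
exists (p - s), 1%:M; split; first exact: orthogonal_mx1.
move=> _ [x Sx <-]; rewrite mul1mx; apply/interior_enormP.
have xs : enorm (x - s) < r by apply: le_lt_trans Sr; exact: diam_ge.
exists (r - enorm (x - s)); first by rewrite subr_gt0.
move=> y yx; apply: rF; apply: le_lt_trans (enorm_triangle (p - s + x) _ _) _.
rewrite (_ : p - s + x - p = x - s); first by move: yx; lra.
by apply/matrixP => i j; rewrite !mxE; ring.
Qed.

(** A pair of points farther apart than any two points of [F] does not fit, so the
    radii are bounded. *)
Lemma covering_radius_has_sup F : convex_body F ->
  has_sup [set d : R | 0 <= d /\
         forall S, compact S -> diam S < d -> covers F° S].
Proof.
move=> bF; have [d d0 dF] := covers_small bF.
split; first by exists d; split=> //; exact: ltW.
have [cF _ _] := bF; have [M M0 FM] := compact_enorm_bounded cF.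
exists (2 * M + 1) => {d0 dF}d [d0 dF]; rewrite leNgt; apply/negP => Md.
(* The ray from 0 along [const_mx 1] supplies a vector of norm [2 * M + 1]. *)
have v0 : (const_mx 1 : 'cV[R]_2) != 0.
  apply/eqP => /matrixP/(_ ord0 ord0); rewrite !mxE => /eqP.
  by rewrite oner_eq0.
have M1 : 0 <= 2 * M + 1 by lra.
have [|s _] := @ray_meets_circle R 0 _ (2 * M + 1) v0; first by rewrite enorm0.
rewrite add0r; set x := _ *: _ => xM.
have [||a [Q [oQ aQF]]] := dF ([set 0] `|` [set x]).
- by apply: compactU; exact: compact_set1.
- apply: le_lt_trans Md; apply: diam_le => // u v [->|->] [->|->];
    by rewrite ?subrr ?subr0 ?sub0r ?enormN ?enorm0 ?xM.
have F0 : F (a + Q *m 0).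
  by apply: interior_subset; apply: aQF; exists 0 => //; left.
have Fx : F (a + Q *m x).
  by apply: interior_subset; apply: aQF; exists x => //; right.
have := enormD (a + Q *m x) (- (a + Q *m 0)).
rewrite enormN opprD addrACA subrr add0r -mulmxBr subr0 enorm_orthogonal// xM.
have := FM _ F0; have := FM _ Fx; lra.
Qed.

Lemma covering_radius_gt0 F : convex_body F -> 0 < diam_covering_radius F.
Proof.
move=> bF; have [d d0 dF] := covers_small bF.
apply: (lt_le_trans d0); apply: sup_upper_bound.
  exact: covering_radius_has_sup.
by split=> //; exact: ltW.
Qed.

Lemma covers_lt_radius F S : convex_body F -> compact S ->
  diam S < diam_covering_radius F -> covers F° S.
Proof.
move=> bF cS; rewrite -subr_gt0 => SF.
have [d [_ dF]] := sup_adherent SF (covering_radius_has_sup bF).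
by rewrite subKr => /dF; apply.
Qed.

Lemma escape_diam_ge F gamma : convex_body F -> escape_path F gamma ->
  diam_covering_radius F <= path_diam gamma.
Proof.
move=> bF [cg eg]; rewrite leNgt; apply/negP.
by move=> /(covers_lt_radius bF (trace_compact cg))[a [Q [oQ /(eg _ _ oQ)]]].
Qed.

(** Just above the covering radius there are compact sets that do not fit; the
    loops built from them share their Lipschitz constant, and a limit of these
    loops is extremal. *)
Lemma critical_escape_loop F : convex_body F -> exists gamma L r,
  [/\ lipschitz_loop L r gamma, escape_path F gamma &
    path_diam gamma = diam_covering_radius F].
Proof.
move=> bF; have [cF /convex_planeP vF _] := bF.
set rho := diam_covering_radius F.
have rho0 : 0 < rho := covering_radius_gt0 bF.
have /choice[g gP] n : exists gamma,
    [/\ lipschitz_loop (4 * pi * (rho + 1)) (rho + 1) gamma,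
      forall s t, enorm (gamma s - gamma t) <= rho + n.+1%:R^-1
      & escape_path F gamma].
  have n0 : 0 < n.+1%:R^-1 :> R by rewrite invr_gt0.
  have : ~ (forall S, compact S -> diam S < rho + n.+1%:R^-1 -> covers F° S).
    move=> H; suff : rho + n.+1%:R^-1 <= rho by rewrite gerDl leNgt n0.
    apply: sup_upper_bound; first exact: covering_radius_has_sup.
    by split=> //; rewrite addr_ge0// ltW.
  move=> /existsNP[S /not_implyP[cS /not_implyP[Sd nS]]].
  apply: (escape_loop_of_compact cF vF cS) => //.
  - by move=> x y Sx Sy; apply: le_trans (ltW Sd); exact: diam_ge.
  - by rewrite addr_gt0.
  - by rewrite lerD2l invf_le1// ler1n.
have [gamma [loop gd eg]] := escape_loop_limit cF gP.
exists gamma, (4 * pi * (rho + 1)), (rho + 1); split=> //.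
apply/eqP; rewrite eq_le escape_diam_ge// andbT.
by apply: diam_le => [|_ _ [s _ <-] [t _ <-]]; [exact: ltW|exact: gd].
Qed.

Lemma escape_diameter_radius F : convex_body F ->
  escape_diameter F = diam_covering_radius F.
Proof.
move=> bF; have [gamma [L [r [_ eg dg]]]] := critical_escape_loop bF.
apply/eqP; rewrite eq_le; apply/andP; split.
  rewrite -dg; apply: ge_inf; last by exists gamma.
  by exists (diam_covering_radius F) => _ [h eh <-]; exact: escape_diam_ge.
apply: lb_le_inf; first by exists (path_diam gamma), gamma.
by move=> _ [h eh <-]; exact: escape_diam_ge.
Qed.

End Critical.

(** * Universal covers *)

Section Covering.
Context {R : realType}.
Implicit Types (x y z p u v w a : 'cV[R]_2) (Q : 'M[R]_2) (S F K : set 'cV[R]_2).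

(** The norms of the images of (1, 0), (0, 1) and (1, 1) determine the Gram matrix
    of the columns. *)
Lemma isometry_orthogonal Q : (forall x, enorm (Q *m x) = enorm x) ->
  orthogonal_mx Q.
Proof.
move=> Qn; apply: mulmx1C.
have Qd x : dot (Q *m x) (Q *m x) = dot x x by rewrite -!enorm_sqr Qn.
pose vec (b c : R) : 'cV[R]_2 := \col_i (if i == ord0 then b else c).
have := Qd (vec 1 0); have := Qd (vec 0 1); have := Qd (vec 1 1).
rewrite !dotE !mxE !sum_ord2 !mxE /= => h11 h01 h10.
apply/matrixP; apply: ord2_ind; apply: ord2_ind; rewrite !mxE sum_ord2 !mxE /=;
  move: h11 h01 h10; lra.
Qed.

Lemma diam_scale (c : R) S : 0 <= c -> compact S ->
  diam (scale_set c S) <= c * diam S.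
Proof.
move=> c0 cS; apply: diam_le; first by rewrite mulr_ge0// diam_ge0.
move=> _ _ [x Sx <-] [y Sy <-]; rewrite -scalerBr enormZ ger0_norm//.
by rewrite ler_wpM2l// diam_ge.
Qed.

Lemma scale_compact (c : R) S : compact S -> compact (scale_set c S).
Proof.
move=> cS; apply: continuous_compact => //; apply: continuous_subspaceT.
by apply: (@enorm_lipschitz_continuous _ _ `|c|) => x y; rewrite -scalerBr enormZ.
Qed.

(** Rigid motions with bounded translation vectors form a compact set. A motion
    is coded by its translation vector, at index [None], and the columns of
    its matrix; the limit matrix is orthogonal because it preserves norms. *)
Lemma rigid_motions_cluster (M : R) (a_ : nat -> 'cV[R]_2) (Q_ : nat -> 'M[R]_2) :
  (forall n, enorm (a_ n) <= M) -> (forall n, orthogonal_mx (Q_ n)) ->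
  exists a Q, orthogonal_mx Q /\
    forall x (e : R) N, 0 < e -> exists2 n, (N <= n)%N &
      enorm (a_ n + Q_ n *m x - (a + Q *m x)) < e.
Proof.
move=> aM oQ.
pose g n (o : option 'I_2) := if o is Some j then col j (Q_ n) else a_ n.
have [|f fP] := @plane_cluster R _ (M + 1) g.
  have M0 : 0 <= M := le_trans (enorm_ge0 _) (aM 0%N).
  move=> n [j|] /=; last by rewrite (le_trans (aM n))// lerDl.
  rewrite colE enorm_orthogonal//; apply: (@le_trans _ _ 1); last by rewrite lerDr.
  rewrite enorm_leP// dotE !mxE -!expr2 expr1n.
  by move: j; apply: ord2_ind; rewrite /= ?expr0n ?expr1n ?addr0 ?add0r.
pose Q : 'M[R]_2 := \matrix_(i, j) f (Some j) i ord0.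
have near_motion x (e : R) N : 0 < e -> exists n, [/\ (N <= n)%N,
    enorm (a_ n - f None) < e & enorm (Q_ n *m x - Q *m x) < e].
  move=> e0; pose c := `|x ord0 ord0| + `|x ord_max ord0| + 1.
  have c1 : 1 <= c by rewrite lerDr addr_ge0.
  have c0 : 0 < c by lra.
  have ec : e / c <= e by rewrite ler_pdivrMr// ler_peMr// ltW.
  have [n Nn fn] := fP (None :: map Some (enum 'I_2)) (e / c) N (divr_gt0 e0 c0).
  exists n; split=> //.
    by apply: lt_le_trans ec; apply: (fn None); rewrite in_cons eqxx.
  have col_le j : enorm (col j (Q_ n - Q)) <= e / c.
    rewrite (_ : col j _ = g n (Some j) - f (Some j)); last first.
      by apply/colP => i; rewrite !mxE.
    apply/ltW/fn; rewrite in_cons; apply/orP; right.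
    by rewrite map_f// mem_enum.
  rewrite -mulmxBl.
  rewrite (_ : _ *m x = x ord0 ord0 *: col ord0 (Q_ n - Q) +
    x ord_max ord0 *: col ord_max (Q_ n - Q)); last first.
    by apply/colP => i; rewrite !mxE sum_ord2 !mxE; ring.
  apply: le_lt_trans (enormD _ _) _; rewrite !enormZ.
  have ee : e / c * c = e by rewrite divfK// gt_eqF.
  have ec0 : 0 < e / c by rewrite divr_gt0.
  apply: (@le_lt_trans _ _ (e / c * (c - 1))).
    rewrite /c addrK mulrDr; apply: lerD; rewrite mulrC ler_wpM2r//.
  by rewrite mulrBr mulr1 ee ltrBlDr ltrDl.
exists (f None), Q; split.
  apply: isometry_orthogonal => x; apply/eqP; rewrite eq_le.
  apply/andP; split; apply/ler_addgt0Pl => e e0;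
    have [n [_ _ nx]] := near_motion x e 0%N e0;
    have xE := enorm_orthogonal x (oQ n).
    have := enormD (Q_ n *m x) (Q *m x - Q_ n *m x).
    rewrite addrC subrK (enormBC (Q *m x)) xE; lra.
  have := enormD (Q *m x) (Q_ n *m x - Q *m x).
  rewrite addrC subrK xE; lra.
move=> x e N e0; have e2 : 0 < e / 2 by rewrite divr_gt0.
have [n [Nn na nx]] := near_motion x _ N e2; exists n => //.
rewrite opprD addrACA; apply: le_lt_trans (enormD _ _) _; lra.
Qed.

(** The copies of [(n + 1) / (n + 2) * S] in [F] converge along a subsequence
    to a copy of [S], which lies in [F] because [F] is closed. *)
Lemma covers_le_radius F S : convex_body F -> compact S ->
  diam S <= diam_covering_radius F -> covers F S.
Proof.
move=> bF cS SF; have rho0 := covering_radius_gt0 bF.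
have [cF _ _] := bF; have [M M0 FM] := compact_enorm_bounded cF.
have [MS MS0 SM] := compact_enorm_bounded cS.
have [[s Ss]|/covers_empty] := pselect (S !=set0); last exact.
pose th n : R := 1 - n.+2%:R^-1.
have th0 n : 0 <= th n by rewrite subr_ge0 invf_le1// ler1n.
have th1 n : th n < 1 by rewrite gtrBl invr_gt0.
have /choice[aQ aQP] n : exists aQ : 'cV[R]_2 * 'M[R]_2, orthogonal_mx aQ.2 /\
    forall x, S x -> F (aQ.1 + aQ.2 *m (th n *: x)).
  have [|a [Q [oQ aQF]]] := covers_lt_radius bF (@scale_compact (th n) _ cS).
    apply: (le_lt_trans (diam_scale (th0 n) cS)).
    apply: (@le_lt_trans _ _ (th n * diam_covering_radius F)).
      exact: ler_wpM2l.
    by rewrite gtr_pMl.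
  exists (a, Q); split=> //= x Sx; apply: interior_subset; apply: aQF.
  by exists (th n *: x) => //; exists x.
have thx n x : S x -> enorm (th n *: x) <= MS.
  move=> Sx; rewrite enormZ ger0_norm//; apply: le_trans (SM _ Sx).
  by rewrite ler_piMl ?enorm_ge0// ltW.
have [|n|a [Q [oQ aQl]]] :=
    @rigid_motions_cluster (M + MS) (fun n => (aQ n).1) (fun n => (aQ n).2).
- move=> n; have [on Fn] := aQP n.
  have := enormD ((aQ n).1 + (aQ n).2 *m (th n *: s)) (- ((aQ n).2 *m (th n *: s))).
  rewrite addrK enormN enorm_orthogonal//.
  have := FM _ (Fn _ Ss); have := thx n _ Ss; lra.
- by have [] := aQP n.
exists a, Q; split=> // _ [x Sx <-].
move/compact_closed_plane/closed_enormP : cF; apply => e e0.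
have [N NP] := natSinv_small (divr_gt0 e0 (mulr_gt0 (ltr0Sn R 1) MS0)).
have e2 : 0 < e / 2 by rewrite divr_gt0.
have [n Nn xn] := aQl x (e / 2) N e2.
have [on Fn] := aQP n.
exists ((aQ n).1 + (aQ n).2 *m (th n *: x)); first exact: Fn.
apply: le_lt_trans (enorm_triangle ((aQ n).1 + (aQ n).2 *m x) _ _) _.
rewrite opprD addrACA subrr add0r -mulmxBr enorm_orthogonal//.
rewrite (_ : th n *: x - x = - (n.+2%:R^-1 *: x)); last first.
  by rewrite /th scalerBl scale1r addrAC subrr add0r.
rewrite enormN enormZ ger0_norm ?invr_ge0//.
have h1 : n.+2%:R^-1 < e / (2 * MS) by apply: NP; exact: leqW.
have h2 := SM _ Sx.
have h4 : 0 < n.+2%:R^-1 :> R by rewrite invr_gt0.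
have h5 : e / (2 * MS) * MS = e / 2 by field; rewrite gt_eqF.
have h6 : n.+2%:R^-1 * enorm x <= n.+2%:R^-1 * MS by rewrite ler_wpM2l// ltW.
have h7 : n.+2%:R^-1 * MS < e / (2 * MS) * MS by rewrite ltr_pM2r.
rewrite [e]splitr ltrD//; by apply: le_lt_trans h6 _; rewrite -h5.
Qed.

(** A copy of [S / l] in [F], shrunk by [l < 1] towards an interior point, is a
    copy of [S] in the interior. *)
Lemma universal_cover_radius_ge1 F : lebesgue_universal_cover F ->
  1 <= diam_covering_radius F.
Proof.
move=> [bF uF]; apply: sup_upper_bound; first exact: covering_radius_has_sup.
split=> // S cS S1.
(* The 1 / 2 only keeps [l] positive when [S] has diameter 0. *)
pose l := Num.max (diam S) (1 / 2).
have l0 : 0 < l by rewrite lt_max divr_gt0// orbT.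
have l1 : l < 1 by rewrite gt_max S1/= ltr_pdivrMr// mul1r ltr1n.
have lS : diam S <= l by rewrite le_max lexx.
have [|a [Q [oQ aQF]]] := uF _ (@scale_compact l^-1 _ cS).
  apply: le_trans (diam_scale _ cS) _; first by rewrite invr_ge0 ltW.
  by rewrite mulrC ler_pdivrMr// mul1r.
have [_ /convex_planeP vF [p /interior_enormP[r r0 rF]]] := bF.
exists (l *: a + (1 - l) *: p), Q; split=> // _ [x Sx <-].
have Fx : F (a + Q *m (l^-1 *: x)).
  by apply: aQF; exists (l^-1 *: x) => //; exists x.
have l1' : 0 < 1 - l by rewrite subr_gt0.
apply/interior_enormP; exists ((1 - l) * r); first by rewrite mulr_gt0.
move=> y yx.
(* Any [y] close to the shrunk copy of [x] is the combination, with weights [l] and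
   [1 - l], of the copy in [F] and of a point [q] of the disc around [p]. *)
pose q := (1 - l)^-1 *: (y - (l *: a + (1 - l) *: p + Q *m x)) + p.
have Fq : F q.
  apply: rF; rewrite /q addrK enormZ gtr0_norm ?invr_gt0//.
  by rewrite mulrC ltr_pdivrMr// mulrC.
rewrite (_ : y = l *: (a + Q *m (l^-1 *: x)) + (1 - l) *: q).
  by apply: vF => //; rewrite !ltW.
rewrite /q -scalemxAr [l *: (_ + _)]scalerDr [l *: (_ *: _)]scalerA.
rewrite [(1 - l) *: (_ + p)]scalerDr [(1 - l) *: (_ *: _)]scalerA.
rewrite !divff ?gt_eqF// !scale1r.
by move: (Q *m x) => Qx; apply/matrixP => i j; rewrite !mxE; ring.
Qed.

Lemma scale_convex_body (c : R) F : 0 < c -> convex_body F ->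
  convex_body (scale_set c F).
Proof.
move=> c0 [cF /convex_planeP vF [p /interior_enormP[r r0 rF]]]; split.
- exact: scale_compact.
- apply/convex_planeP => _ _ t [x Fx <-] [y Fy <-] t01.
  exists (t *: x + (1 - t) *: y); first exact: vF.
  by apply/matrixP => i j; rewrite !mxE; ring.
- exists (c *: p); apply/interior_enormP; exists (c * r); first by rewrite mulr_gt0.
  move=> y yp; exists (c^-1 *: y); last by rewrite scalerA divff ?gt_eqF// scale1r.
  apply: rF; rewrite (_ : _ - p = c^-1 *: (y - c *: p)); last first.
    by rewrite scalerBr scalerA mulVf ?gt_eqF// scale1r.
  by rewrite enormZ gtr0_norm ?invr_gt0// mulrC ltr_pdivrMr// mulrC.
Qed.

Lemma scaled_body_universal F : convex_body F ->
  lebesgue_universal_cover (scale_set (diam_covering_radius F)^-1 F).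
Proof.
move=> bF; have d0 := covering_radius_gt0 bF.
set d := diam_covering_radius F in d0 *.
split; first by apply: scale_convex_body => //; rewrite invr_gt0.
move=> S cS S1; have [|a [Q [oQ aQF]]] := covers_le_radius bF (@scale_compact d _ cS).
  apply: le_trans (diam_scale (ltW d0) cS) _.
  by rewrite -/d ler_piMr// ltW.
exists (d^-1 *: a), Q; split=> // _ [x Sx <-].
exists (a + Q *m (d *: x)).
  by apply: aQF; exists (d *: x) => //; exists x.
by rewrite scalerDr -scalemxAr scalerA mulVf ?gt_eqF// scale1r.
Qed.

End Covering.

(** * Area *)

Section Area.
Context {R : realType}.
Implicit Types (S F : set 'cV[R]_2).

Local Notation mR := (measurableTypeR R).
Local Notation mu := (@lebesgue_measure R).

(** An open set is the union of the open squares with rational centre and rational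
    half-side that it contains. *)
Lemma open_measurable_plane (O : set (R * R)) :
  open O -> measurable (O : set (mR * mR)).
Proof.
move=> oO.
pose B (q : rat * rat * rat) : set (mR * mR) :=
  `](ratr q.1.1 - ratr q.2), (ratr q.1.1 + ratr q.2)[%classic `*`
  `](ratr q.1.2 - ratr q.2), (ratr q.1.2 + ratr q.2)[%classic.
pose C q := if `[< B q `<=` O >] then B q else set0.
rewrite (_ : O = \bigcup_q C q).
  apply: countable_bigcupT_measurable; first exact: countableP.
  by move=> q; rewrite /C; case: ifP => // _; exact: measurableX.
apply/seteqP; split=> [[x y] Oxy|z [q _]]; last first.
  by rewrite /C; case: ifPn => // /asboolP; apply.
have [e /= e0 eO] : exists2 e, 0 < e & ball (x, y) e `<=` O.
  by apply/nbhs_ballP; apply: open_nbhs_nbhs.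
(* Two points of a square of half-side [q] differ by less than [2 * q < e] in each
   coordinate. *)
have [q] := @rat_in_itvoo R 0 (e / 2) (divr_gt0 e0 (ltr0Sn _ _)).
rewrite in_itv/= => /andP[q0 qe].
have app (c : R) : exists p : rat, ratr p - ratr q < c < ratr p + ratr q.
  have [|p] := @rat_in_itvoo R (c - ratr q) (c + ratr q); first by lra.
  by rewrite in_itv/= => pc; exists p; lra.
have [p px] := app x; have [p' py] := app y.
have Bxy : B (p, p', q) (x, y) by split; rewrite /= in_itv/=.
exists (p, p', q) => //; rewrite /C; case: ifPn => // /asboolP[] [u v] [/=].
rewrite !in_itv/= => uP vP; apply: eO; split; rewrite /ball/= ltr_norml; lra.
Qed.

Lemma compact_measurable_plane (K : set (R * R)) :
  compact K -> measurable (K : set (mR * mR)).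
Proof.
move=> cK; rewrite -(setCK K); apply: measurableC; apply: open_measurable_plane.
by apply: closed_openC; apply: compact_closed cK; exact: norm_hausdorff.
Qed.

(** Multiplication with its source and target typed as measurable spaces, which is
    what push-forwards of Lebesgue measure require. *)
Definition dilation (c : R) (x : mR) : mR := c * x.

Lemma measurable_dilation (c : R) : measurable_fun [set: mR] (dilation c).
Proof. exact: mulrl_measurable. Qed.

(** Dividing the push-forward by [c] gives a measure that agrees with Lebesgue
    measure on intervals. *)
Lemma lebesgue_measure_dilation (c : R) (A : set mR) : 0 < c -> measurable A ->
  mu (dilation c^-1 @^-1` A) = (c%:E * mu A)%E.
Proof.
move=> c0 mA.
have ci0 : 0 <= c^-1 by rewrite invr_ge0 ltW.
have mf := measurable_dilation c^-1.
suff -> : mu A = (c^-1%:E * mu (dilation c^-1 @^-1` A))%E.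
  by rewrite muleA -EFinM divff ?gt_eqF// mul1e.
have := @lebesgue_measure_unique R
  (mscale (NngNum ci0) (pushforward mu (dilation c^-1))).
apply => // _ [[a b] _ <-].
transitivity (c^-1%:E * mu (dilation c^-1 @^-1` `]a, b]))%E; last by [].
rewrite (_ : _ @^-1` _ = `]c * a, c * b]%classic); last first.
  apply/seteqP; split=> x /=; rewrite !in_itv/= /dilation.
    by rewrite mulrC ltr_pdivlMr// ler_pdivrMr// ![_ * c]mulrC.
  by rewrite [c^-1 * _]mulrC ltr_pdivlMr// ler_pdivrMr// ![_ * c]mulrC.
rewrite !lebesgue_measure_itv/= !lte_fin ltr_pM2l//.
case: ifPn => _; last by rewrite mule0.
by rewrite -!EFinD -EFinM -mulrBr mulKf// gt_eqF.
Qed.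

Lemma product_lebesgue_measure_dilation (c : R) (X : set (mR * mR)) : 0 < c ->
  measurable X ->
  (mu \x mu)%E ((fun z => (dilation c^-1 z.1, dilation c^-1 z.2)) @^-1` X) =
  ((c ^+ 2)%:E * (mu \x mu) X)%E.
Proof.
move=> c0 mX.
set f := fun z => _.
have mf : measurable_fun [set: mR * mR] f.
  apply/measurable_fun_pairP; split.
    exact: (measurableT_comp (measurable_dilation _) measurable_fst).
  exact: (measurableT_comp (measurable_dilation _) measurable_snd).
have ci0 : 0 <= (c ^+ 2)^-1 by rewrite invr_ge0 sqr_ge0.
suff -> : (mu \x mu)%E X = ((c ^+ 2)^-1%:E * (mu \x mu) (f @^-1` X))%E.
  by rewrite muleA -EFinM divff ?mul1e// expf_neq0// gt_eqF.
have := @product_measure_unique _ _ _ _ R mu mu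
  (mscale (NngNum ci0) (pushforward (mu \x mu)%E f)).
apply => // A B mA mB.
transitivity ((c ^+ 2)^-1%:E * (mu \x mu)
  ((dilation c^-1 @^-1` A) `*` (dilation c^-1 @^-1` B)))%E; first by [].
have mP (C : set mR) : measurable C -> measurable (dilation c^-1 @^-1` C).
  by move=> mC; rewrite -[X in measurable X]setTI; exact: measurable_dilation.
rewrite product_measure1E; [|exact: mP|exact: mP].
rewrite -[X in (_ * X)%E]/(mu (dilation c^-1 @^-1` A) *
  mu (dilation c^-1 @^-1` B))%E.
rewrite !lebesgue_measure_dilation// muleACA -EFinM -expr2.
by rewrite [LHS]muleA -EFinM mulVf ?mul1e// expf_neq0// gt_eqF.
Qed.

Lemma area_scale (c : R) F : 0 < c -> compact F ->
  area (scale_set c F) = ((c ^+ 2)%:E * area F)%E.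
Proof.
move=> c0 cF; rewrite /area -product_lebesgue_measure_dilation//.
  congr ((mu \x mu)%E _); apply/seteqP; split=> [_ [_ [x Fx <-] <-]|[u v] [x Fx]].
    by exists x => //; rewrite !mxE /dilation !mulKf ?gt_eqF.
  rewrite /dilation => -[/= uE vE]; exists (c *: x); first by exists x.
  by rewrite !mxE uE vE !mulVKf ?gt_eqF.
apply: compact_measurable_plane; apply: continuous_compact => //.
apply: continuous_subspaceT => x.
have h0 := @coord_continuous R 2 1 ord0 ord0 x.
have h1 := @coord_continuous R 2 1 ord_max ord0 x.
exact: (cvg_pair h0 h1).
Qed.

Lemma area_ge0 S : (0 <= area S)%E.
Proof. exact: measure_ge0. Qed.

End Area.

Theorem theorem3 (R : realType) :
  (forall F : set 'cV[R]_2, convex_body F ->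
    [/\ exists gamma : R -> 'cV[R]_2,
          [/\ escape_path F gamma, rectifiable gamma
            & path_diam gamma = escape_diameter F],
        escape_diameter F = diam_covering_radius F
      & lebesgue_universal_cover (scale_set (escape_diameter F)^-1 F) /\
        area (scale_set (escape_diameter F)^-1 F) =
          (area F / ((escape_diameter F) ^+ 2)%:E)%E])
  /\
  @universal_covering_constant R =
    ereal_inf [set (area F / ((escape_diameter F) ^+ 2)%:E)%E
              | F in @convex_body R].
Proof.
have areaD (F : set 'cV[R]_2) : convex_body F ->
    area (scale_set (diam_covering_radius F)^-1 F) =
    (area F / ((diam_covering_radius F) ^+ 2)%:E)%E.
  move=> bF; have d0 := covering_radius_gt0 bF; have [cF _ _] := bF.
  rewrite area_scale ?invr_gt0// muleC exprVn; congr (_ * _)%E.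
  by rewrite inver expf_eq0/= gt_eqF.
split=> [F bF|].
  have [gamma [L [r [loop eg dg]]]] := critical_escape_loop bF.
  rewrite escape_diameter_radius//; split=> //.
    by exists gamma; split=> //; exact: lipschitz_loop_rectifiable loop.
  by split; [exact: scaled_body_universal|exact: areaD].
apply/eqP; rewrite eq_le; apply/andP; split; apply: le_ereal_inf_tmp => m [F].
  move=> bF <-; apply: ereal_inf_lbound.
  rewrite escape_diameter_radius// -areaD//.
  exists (scale_set (diam_covering_radius F)^-1 F) => //.
  exact: scaled_body_universal.
move=> uF <-; have [bF _] := uF.
apply: ge_ereal_inf; exists (area F / ((escape_diameter F) ^+ 2)%:E)%E.
  by exists F.
rewrite escape_diameter_radius//.
have d1 := universal_cover_radius_ge1 uF; have d0 := covering_radius_gt0 bF.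
rewrite inver expf_eq0/= gt_eqF//.
rewrite -[leRHS]mule1; apply: lee_wpmul2l; first exact: area_ge0.
by rewrite lee_fin invf_le1 ?exprn_gt0// exprn_ege1.
Qed.
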